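(* Let $k$ be an algebraically closed field of characteristic zero and $G$ a finite group. Put $V_G=\mathbb C\Omega_G$, $n_G=|\Omega_G|$, $\mathcal J_G=\mathbb C\otimes_{\mathbb Z}J_G$, let $c_G$ be the symmetric bilinear form on $V_G$ with matrix $C_G=(c_{b,c})_{b,c\in\Omega_G}$, and identify $\mathcal J_G\cong V_G\otimes V_G\cong\operatorname{Mat}_{n_G}(\mathbb C)$ as vector spaces, $E_{a,b}\leftrightarrow a\otimes b\leftrightarrow$ the $(a,b)$ matrix unit. Let $r_G=\operatorname{rank}_{\mathbb C}(C_G)$ and $K_G=\operatorname{Rad}(c_G)$. Then $$\operatorname{Jac}(\mathcal J_G)=K_G\otimes V_G+V_G\otimes K_G=\{X\in\operatorname{Mat}_{n_G}(\mathbb C)\mid C_GXC_G=0\}.$$ Moreover, $$\mathcal J_G/\operatorname{Jac}(\mathcal J_G)\cong\operatorname{Mat}_{r_G}(\mathbb C),\qquad\dim\operatorname{Jac}(\mathcal J_G)=n_G^2-r_G^2.$$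
   Context: $\Omega_G$ is the set of $G$-conjugacy classes $[H,\alpha]$ of pairs $(H,[\alpha])$ with $H\le G$ and $[\alpha]\in H^2(H,k^\times)$ (trivial action); it indexes the equivalence classes of indecomposable finite semisimple $\mathrm{Vec}_G$-module categories $\mathcal M_a$, $a\in\Omega_G$. $J_G$ is the ideal of the ring $R_G$ (the Grothendieck ring of finite semisimple $\mathrm{Vec}_G$-bimodule categories under relative tensor product over $\mathrm{Vec}_G$) with $\mathbb Z$-basis $E_{a,b}=[\mathcal M_a\boxtimes\mathcal M_b^\vee]$, $a,b\in\Omega_G$, where $\mathcal M_b^\vee$ is the dual (opposite) right module category. Its product is $E_{a,b}E_{c,d}=c_{b,c}E_{a,d}$, where $c_{b,c}=\operatorname{rk}\operatorname{Fun}_{\mathrm{Vec}_G}(\mathcal M_b,\mathcal M_c)$ is the number of isomorphism classes of simple objects; explicitly, for $b=[H,\alpha]$, $c=[K,\beta]$, $$c_{b,c}=\sum_{g\in H\backslash G/K}\bigl|\mathrm{Irr}\bigl(k_{\theta_g}[H\cap gKg^{-1}]\bigr)\bigr|,\qquad[\theta_g]=\bigl[\alpha^{-1}|_{H\cap gKg^{-1}}\cdot{}^g\beta|_{H\cap gKg^{-1}}\bigr],$$ with $k_\theta[\,\cdot\,]$ the twisted group algebra and ${}^g\beta(gxg^{-1},gyg^{-1})=\beta(x,y)$. The matrix $C_G$ is symmetric. Under the matrix identification, the product on $\mathcal J_G$ is $X*Y=XC_GY$. The algebra $\mathcal J_G$ is finite-dimensional and not assumed unital; $\operatorname{Jac}$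 denotes its Jacobson radical, i.e. its largest nilpotent two-sided ideal. $\operatorname{Rad}(c_G)=\{v\in V_G: c_G(v,w)=0\ \forall w\in V_G\}$. *)

(* Defs.v *)
From HB Require Import structures.
From mathcomp Require Import all_boot all_order all_algebra all_fingroup.
From mathcomp Require Import finmap boolp classical_sets cardinality reals.
From mathcomp Require Import complex ring.
Set Implicit Arguments.
Unset Strict Implicit.
Unset Printing Implicit Defensive.
Import GRing.Theory.
Local Open Scope ring_scope.

Section Cocycles.
Variables (k : fieldType) (gT : finGroupType).

(* Only the values on L x L matter when a cochain is used on a subgroup L. *)
Definition cochain : Type := {ffun gT * gT -> k}.
HB.instance Definition _ := Choice.on cochain.

Definition is_cocycle (L : {set gT}) (a : cochain) : bool :=
  [forall x in L, forall y in L, a (x, y) != 0] &&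
  [forall x in L, forall y in L, forall z in L,
     a (y, z) * a (x, (y * z)%g) == a ((x * y)%g, z) * a (x, y)].

(* [a] = [b] in H^2(L, k^x), with trivial action. *)
Definition cohomologous (L : {set gT}) (a b : cochain) : Prop :=
  exists f : gT -> k, (forall x, x \in L -> f x != 0) /\
    (forall x y, x \in L -> y \in L ->
       b (x, y) = a (x, y) * (f x * f y / f (x * y)%g)).

(* In MathComp, x ^ g = g^-1 * x * g, so this is the left conjugate ^g a, a
   cochain on g L g^-1 = L :^ g^-1 whenever a is a cochain on L. *)
Definition conj_cochain (g : gT) (a : cochain) : cochain :=
  [ffun p => a (p.1 ^ g, p.2 ^ g)%g].

Lemma is_cocycleP (L : {set gT}) (a : cochain) :
  reflect ((forall x y, x \in L -> y \in L -> a (x, y) != 0) /\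
           (forall x y z, x \in L -> y \in L -> z \in L ->
     a (y, z) * a (x, (y * z)%g) = a ((x * y)%g, z) * a (x, y)))
    (is_cocycle L a).
Proof.
apply: (iffP andP) => [[/forall_inP h1 /forall_inP h2]|[h1 h2]]; split.
- by move=> x y /h1/forall_inP; apply.
- by move=> x y z /h2/forall_inP h /h/forall_inP h' /h'/eqP.
- by apply/forall_inP => x xL; apply/forall_inP => y yL; apply: h1.
- apply/forall_inP => x xL; apply/forall_inP => y yL; apply/forall_inP => z zL.
  by apply/eqP; apply: h2.
Qed.

Lemma conj_cocycle (L : {set gT}) (g : gT) (a : cochain) :
  is_cocycle L a -> is_cocycle (L :^ g^-1)%g (conj_cochain g a).
Proof.
move=> /is_cocycleP[h1 h2]; apply/is_cocycleP; split=> [x y|x y z];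
  rewrite !mem_conjgV !ffunE /=; first exact: h1.
by rewrite !conjMg; apply: h2.
Qed.

Lemma sub_cocycle (L M : {set gT}) (a : cochain) :
  M \subset L -> is_cocycle L a -> is_cocycle M a.
Proof.
move=> /fintype.subsetP s /is_cocycleP[h1 h2]; apply/is_cocycleP.
by split=> [x y /s xL /s|x y z /s xL /s yL /s]; [apply: h1|apply: h2].
Qed.

Lemma div_cocycle (L : {set gT}) (a b : cochain) :
  is_cocycle L a -> is_cocycle L b ->
  is_cocycle L [ffun p => (a p)^-1 * b p].
Proof.
move=> /is_cocycleP[a1 a2] /is_cocycleP[b1 b2]; apply/is_cocycleP.
split=> [x y xL yL|x y z xL yL zL]; rewrite !ffunE.
  by rewrite mulf_neq0 ?invr_eq0 ?a1 ?b1.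
by rewrite mulrACA -invfM a2 // b2 // invfM mulrACA.
Qed.

End Cocycles.

Section TwistedGroupAlgebra.
Variables (k : fieldType) (gT : finGroupType) (L : {group gT}).

Definition cocycle : Type := {a : cochain k gT | is_cocycle L a}.

(* k_theta[L]: the basis u_x, x in L, multiplies by
   u_x u_y = theta(x, y) u_(x y); theta is not assumed normalized, so the unit
   is theta(1, 1)^-1 u_1. *)
Definition twalg (theta : cocycle) : Type := {ffun [subg L] -> k^o}.

Variable theta : cocycle.
Local Notation A := (twalg theta).
Let th (x y : [subg L]) : k := val theta (sgval x, sgval y).

HB.instance Definition _ := GRing.Lmodule.on A.

Definition twmul (a b : A) : A :=
  [ffun z => \sum_x a x * b (x^-1 * z)%g * th x (x^-1 * z)%g].

Definition twone : A :=
  [ffun z => if z == 1%g then (th 1%g 1%g)^-1 else 0].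

Let th0 x y : th x y != 0.
Proof. by have /is_cocycleP[+ _] := valP theta; apply; apply: subgP. Qed.

Let thA x y z : th y z * th x (y * z)%g = th (x * y)%g z * th x y.
Proof.
by have /is_cocycleP[_] := valP theta; apply; apply: subgP.
Qed.

Let th1x x : th 1%g x = th 1%g 1%g.
Proof. by have := thA 1 1 x; rewrite !mul1g; apply/mulfI/th0. Qed.

Let thx1 x : th x 1%g = th 1%g 1%g.
Proof. by have := thA x 1 1; rewrite !mulg1; move/mulIf => ->. Qed.

Fact twmulA : associative twmul.
Proof.
move=> a b c; apply/ffunP => z; rewrite !ffunE.
under [RHS]eq_bigr => y _ do rewrite ffunE !mulr_suml.
rewrite exchange_big /=; apply: eq_bigr => x _.
rewrite ffunE mulr_sumr mulr_suml.
rewrite [RHS](reindex (fun w => x * w)%g) /=; last first.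
  by exists (fun w => x^-1 * w)%g => w _; rewrite ?mulKg ?mulKVg.
apply: eq_bigr => w _; rewrite mulKg invMg -mulgA.
have := thA x w (w^-1 * (x^-1 * z))%g; rewrite mulKVg => E.
rewrite -!mulrA E; congr (_ * (_ * _)); rewrite [RHS]mulrCA; congr (_ * _).
by rewrite mulrC.
Qed.

Fact twmul1 : left_id twone twmul.
Proof.
move=> a; apply/ffunP => z; rewrite ffunE (bigD1 1%g) //= big1 => [|x /negPf n1].
  by rewrite addr0 ffunE eqxx invg1 mul1g th1x mulrAC mulVf ?mul1r.
by rewrite ffunE n1 !mul0r.
Qed.

Fact twmulr1 : right_id twone twmul.
Proof.
move=> a; apply/ffunP => z; rewrite ffunE (bigD1 z) //= big1 => [|x nx].
  by rewrite addr0 ffunE mulVg eqxx thx1 -mulrA mulVf ?mulr1.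
rewrite ffunE -eq_mulVg1; case: eqP => [E|_]; last by rewrite mulr0 mul0r.
by rewrite E eqxx in nx.
Qed.

Fact twmulDl : left_distributive twmul +%R.
Proof.
move=> a b c; apply/ffunP => z; rewrite !ffunE -big_split /=.
by apply: eq_bigr => x _; rewrite ffunE !mulrDl.
Qed.

Fact twmulDr : right_distributive twmul +%R.
Proof.
move=> a b c; apply/ffunP => z; rewrite !ffunE -big_split /=.
by apply: eq_bigr => x _; rewrite ffunE mulrDr mulrDl.
Qed.

Fact twone_neq0 : twone != 0.
Proof.
apply/eqP => /ffunP/(_ 1%g); rewrite !ffunE eqxx => /eqP.
by rewrite invr_eq0 (negPf (th0 _ _)).
Qed.

HB.instance Definition _ := GRing.Zmodule_isNzRing.Build A
  twmulA twmul1 twmulr1 twmulDl twmulDr twone_neq0.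

Fact twscaleAl (c : k) (a b : A) : c *: (a * b) = (c *: a) * b.
Proof.
apply/ffunP => z; rewrite !ffunE scaler_sumr; apply: eq_bigr => x _.
rewrite ffunE; set u := a x; set v := b _; set w := th _ _.
by change (c * (u * v * w) = c * u * v * w); rewrite !mulrA.
Qed.

HB.instance Definition _ := GRing.Lmodule_isLalgebra.Build k A twscaleAl.

Fact twscaleAr (c : k) (a b : A) : c *: (a * b) = a * (c *: b).
Proof.
apply/ffunP => z; rewrite !ffunE scaler_sumr; apply: eq_bigr => x _.
rewrite ffunE; set u := a x; set v := b _; set w := th _ _.
by change (c * (u * v * w) = u * (c * v) * w); rewrite !mulrA [c * u]mulrC.
Qed.

HB.instance Definition _ := GRing.Lalgebra_isAlgebra.Build k A twscaleAr.

End TwistedGroupAlgebra.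

Section Irr.
Local Open Scope classical_set_scope.
Variables (k : fieldType) (A : algType k).

(* A nonzero finite-dimensional left A-module, in coordinates: k^(n+1), as
   column vectors, with a acting by rho a. *)
Definition mxrep : Type := {n : nat & {lrmorphism A -> 'M[k]_n.+1}}.

Definition mxrep_irr (rho : mxrep) : Prop :=
  forall U : {vspace 'cV[k]_(projT1 rho).+1},
    (forall (a : A) u, u \in U -> projT2 rho a *m u \in U) ->
    U = 0%VS \/ U = fullv.

Definition mxrep_iso (rho sigma : mxrep) : Prop :=
  exists (P : 'M[k]_((projT1 sigma).+1, (projT1 rho).+1))
         (Q : 'M[k]_((projT1 rho).+1, (projT1 sigma).+1)),
    [/\ P *m Q = 1%:M, Q *m P = 1%:M &
        forall a : A, P *m projT2 rho a = projT2 sigma a *m P].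

Definition Irr : set (set mxrep) :=
  [set [set sigma | mxrep_iso rho sigma] | rho in [set rho | mxrep_irr rho]].

(* fset_set is empty on infinite sets; Irr is finite for a finite-dimensional A,
   in particular for a twisted group algebra. *)
Definition nIrr : nat := #|` fset_set Irr|%fset.

End Irr.

Section Omega.
Variables (k : closedFieldType) (gT : finGroupType) (G : {group gT}).

Definition twpair : Type :=
  {p : {group gT} * cochain k gT | (p.1 \subset G) && is_cocycle p.1 p.2}.
HB.instance Definition _ := Choice.on twpair.

Definition tw_grp (p : twpair) : {group gT} := (val p).1.
Definition tw_cochain (p : twpair) : cochain k gT := (val p).2.

Lemma tw_sub (p : twpair) : tw_grp p \subset G.
Proof. by have /andP[] := valP p. Qed.

Lemma tw_cocycle (p : twpair) : is_cocycle (tw_grp p) (tw_cochain p).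
Proof. by have /andP[] := valP p. Qed.

(* (K, [beta]) = (g H g^-1, [^g alpha]) for some g in G. *)
Definition tw_conj (p q : twpair) : bool :=
  `[< exists2 g, g \in G &
      tw_grp q = (tw_grp p :^ g^-1)%g :> {set gT} /\
      cohomologous (tw_grp q) (conj_cochain g (tw_cochain p)) (tw_cochain q) >].

Fact tw_conj_refl : reflexive tw_conj.
Proof.
move=> p; apply/asboolP; exists 1%g; rewrite ?group1 // invg1 conjsg1; split=> //.
exists (fun=> 1); split=> [x _|x y _ _]; first exact: oner_neq0.
by rewrite ffunE /= !conjg1 mulr1 divr1 mulr1.
Qed.

Fact tw_conj_sym : symmetric tw_conj.
Proof.
suff S p q : tw_conj p q -> tw_conj q p by move=> p q; apply/idP/idP; apply: S.
case/asboolP=> g gG [E [f [f0 fE]]]; apply/asboolP; exists g^-1%g; rewrite ?groupV //.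
rewrite invgK E -conjsgM mulVg conjsg1; split=> //.
exists (fun x => (f (x ^ g^-1)%g)^-1).
have mem x : x \in tw_grp p -> (x ^ g^-1)%g \in tw_grp q.
  by rewrite E memJ_conjg.
split=> [x /mem xq|x y /mem xq /mem yq]; first by rewrite invr_eq0 f0.
rewrite ffunE /= fE // ffunE /= !conjgKV conjMg.
set u := f _; set v := f _; set w := f _.
have u0 : u != 0 by apply: f0.
have v0 : v != 0 by apply: f0.
have w0 : w != 0 by apply/f0/groupM.
by rewrite -[u^-1 * _]invfM -invfM mulfK // !mulf_neq0 ?invr_eq0.
Qed.

Fact tw_conj_trans : transitive tw_conj.
Proof.
move=> q p r /asboolP[g gG [E [f [f0 fE]]]] /asboolP[h hG [E' [e [e0 eE]]]].
apply/asboolP; exists (h * g)%g; first exact: groupM.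
split; first by rewrite E' E invMg conjsgM.
exists (fun x => f (x ^ h)%g * e x).
have mem x : x \in tw_grp r -> (x ^ h)%g \in tw_grp q.
  by rewrite E' mem_conjgV.
split=> [x xr|x y xr yr].
  by apply: mulf_neq0; [apply/f0/mem|apply: e0].
rewrite eE // ffunE /= fE; [|exact: mem|exact: mem].
rewrite !ffunE /= -!conjgM -mulrA conjMg; congr (_ * _).
by rewrite mulrACA -invfM mulrACA.
Qed.

Canonical tw_conj_equiv :=
  EquivRel tw_conj tw_conj_refl tw_conj_sym tw_conj_trans.

(* Omega_G, the set of G-conjugacy classes [H, alpha]. *)
Definition Omega : Type := {eq_quot tw_conj_equiv}%qT.
HB.instance Definition _ := gen_eqMixin Omega.
HB.instance Definition _ := gen_choiceMixin Omega.

Definition Omega_class (p : twpair) : Omega := (\pi_{eq_quot tw_conj_equiv} p)%qT.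

Definition Omega_repr (a : Omega) : twpair :=
  generic_quotient.repr (a : {eq_quot tw_conj_equiv}%qT).

Lemma Omega_reprK : cancel Omega_repr Omega_class.
Proof. by move=> a; rewrite /Omega_class /Omega_repr reprK. Qed.

Lemma Omega_classP (p q : twpair) :
  Omega_class p = Omega_class q <-> tw_conj p q.
Proof.
rewrite /Omega_class; split=> [/eqmodP //|pq].
exact/(@eqmodP _ tw_conj_equiv).
Qed.

(* H^2(H, k^x) is finite: every class contains a cocycle with values in the
   #|H|-th roots of unity. *)
Lemma root_cocycle (H : {group gT}) (a : cochain k gT) : is_cocycle H a ->
  exists2 b : cochain k gT, is_cocycle H b /\ cohomologous H a b &
    forall p, b p ^+ #|H| = 1.
Proof.
move=> /is_cocycleP[a0 aA]; set n := #|H|.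
have n0 : (0 < n)%N by apply: cardG_gt0.
pose F x := \prod_(y in H) a (x, y).
have F0 x : x \in H -> F x != 0.
  by move=> xH; apply/prodf_neq0 => y yH; apply: a0.
have aF x y : x \in H -> y \in H -> F y * F x = F (x * y)%g * a (x, y) ^+ n.
  move=> xH yH; rewrite /F [X in _ * X](reindex_inj (mulgI y)) /=.
  under [X in _ * X]eq_bigl => z do rewrite groupMl //.
  rewrite -big_split /= -prodr_const -big_split /=.
  by apply: eq_bigr => z zH; apply: aA.
have rootX (c : k) : {d : k | d ^+ n = c}.
  have : exists d : k, d ^+ n == c.
    have /closed_rootP[d] : size ('X^n - c%:P : {poly k}) != 1%N.
      by rewrite size_XnsubC // eqSS -lt0n.
    by rewrite rootE !hornerE subr_eq0 => dE; exists d.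
  by move=> /sigW[d /eqP dE]; exists d.
pose f x := sval (rootX (F x)^-1).
have fE x : f x ^+ n = (F x)^-1 by rewrite /f; case: (rootX _).
have f0 x : x \in H -> f x != 0.
  by move=> xH; have := F0 x xH; rewrite -invr_eq0 -fE expf_eq0 n0.
pose b0 x y := a (x, y) * (f x * f y / f (x * y)%g).
pose b : cochain k gT :=
  [ffun p => if (p.1 \in H) && (p.2 \in H) then b0 p.1 p.2 else 1].
have bE x y : x \in H -> y \in H -> b (x, y) = b0 x y.
  by move=> xH yH; rewrite ffunE /= xH yH.
exists b; first split.
- apply/is_cocycleP; split=> [x y xH yH|x y z xH yH zH].
    by rewrite bE // !mulf_neq0 ?invr_eq0 ?a0 ?f0 ?groupM.
  rewrite !bE ?groupM // /b0 mulrACA aA // [RHS]mulrACA; congr (_ * _).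
  rewrite mulgA; field.
  by rewrite !f0 ?groupM.
- by exists f; split=> [x|x y xH yH]; [apply: f0|rewrite bE].
- case=> x y; rewrite ffunE /=; case: ifP => [/andP[xH yH]|_]; last by rewrite expr1n.
  rewrite /b0 !exprMn exprVn !fE invrK.
  have -> : a (x, y) ^+ n = F y * F x / F (x * y)%g.
    by rewrite aF // mulrC mulKf // F0 ?groupM.
  by field; rewrite !F0 ?groupM.
Qed.

Lemma Omega_finite : exists s : seq Omega, forall a, a \in s.
Proof.
have [s sP] : exists s : nat -> seq k,
    forall n c, (0 < n)%N -> c ^+ n = 1 -> c \in s n.
  have /choice[s sP] n : exists s : seq k, (0 < n)%N ->
      forall c : k, c ^+ n = 1 -> c \in s.
    have [r rE] := closed_field_poly_normal ('X^n - 1%:P : {poly k}).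
    exists r => n0 c cE; have : root ('X^n - 1%:P) c.
      by rewrite rootE !hornerE cE subrr.
    have l1 : lead_coef ('X^n - 1%:P : {poly k}) = 1.
      by apply/eqP; rewrite -monicE monicXnsubC.
    by rewrite rE l1 scale1r root_prod_XsubC.
  by exists s => n c n0; apply: sP.
pose cands (H : {group gT}) : seq (cochain k gT) :=
  [seq [ffun p => val (t p)] | t : {ffun gT * gT -> seq_sub (s #|H|)}].
pose cl (p : {group gT} * cochain k gT) : option Omega :=
  omap Omega_class (insub p).
exists (pmap cl (flatten [seq [seq (H, b) | b <- cands H] | H : {group gT}])).
move=> x; rewrite mem_pmap; apply/mapP.
have [b [b_c ab] bn] := root_cocycle (tw_cocycle (Omega_repr x)).
set p := Omega_repr x in b_c ab bn *.
exists (tw_grp p, b).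
  apply/flatten_mapP; exists (tw_grp p); rewrite ?mem_enum //.
  apply/map_f/mapP => /=.
  exists [ffun q => SeqSub (sP _ _ (cardG_gt0 _) (bn q))]; rewrite ?mem_enum //.
  by apply/ffunP => q; rewrite !ffunE.
pose P (q : {group gT} * cochain k gT) := (q.1 \subset G) && is_cocycle q.1 q.2.
have pP : P (tw_grp p, b) by rewrite /P tw_sub.
rewrite /cl (insubT P pP) /=; congr Some.
rewrite -[LHS]Omega_reprK; apply/Omega_classP/asboolP.
exists 1%g; rewrite ?group1 // invg1 conjsg1; split=> //.
have [f [f0 fE]] := ab; exists f; split=> // y z yH zH.
by rewrite ffunE /= !conjg1; apply: fE.
Qed.

Fact Omega_enum : {s : seq Omega | Finite.axiom s}.
Proof.
have [s sP] := cid Omega_finite; exists (undup s) => a.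
by rewrite count_uniq_mem ?undup_uniq // mem_undup sP.
Qed.

Let Omega_seq : seq Omega := sval Omega_enum.

Fact Omega_pickleK : pcancel (index^~ Omega_seq) (onth Omega_seq).
Proof.
move=> a; have aP : a \in Omega_seq.
  by rewrite -has_pred1 has_count (svalP Omega_enum).
by rewrite onthE (nth_map a) ?index_mem ?nth_index.
Qed.

HB.instance Definition _ := Choice_isCountable.Build Omega Omega_pickleK.
HB.instance Definition _ := isFinite.Build Omega (svalP Omega_enum).

(* theta_g = alpha^-1 . ^g beta on H :&: g K g^-1, where p = (H, alpha) and
   q = (K, beta). *)
Definition theta_fun (p q : twpair) (g : gT) : cochain k gT :=
  [ffun x => (tw_cochain p x)^-1 * conj_cochain g (tw_cochain q) x].

Fact theta_cocycle (p q : twpair) (g : gT) :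
  is_cocycle (tw_grp p :&: tw_grp q :^ g^-1)%G (theta_fun p q g).
Proof.
apply: div_cocycle.
  exact: sub_cocycle (subsetIl _ _) (tw_cocycle p).
exact: sub_cocycle (subsetIr _ _) (conj_cocycle g (tw_cocycle q)).
Qed.

Definition theta (p q : twpair) (g : gT) :
    cocycle k (tw_grp p :&: tw_grp q :^ g^-1)%G :=
  exist _ (theta_fun p q g) (theta_cocycle p q g).

Definition dcosets (H K : {set gT}) : {set {set gT}} :=
  [set (H :* g * K)%g | g in G].

Definition fun_rank (b c : Omega) : nat :=
  \sum_(D in dcosets (tw_grp (Omega_repr b)) (tw_grp (Omega_repr c)))
    nIrr (twalg (theta (Omega_repr b) (Omega_repr c) (fingroup.repr D))).

End Omega.

Section JG.
Variables (k : closedFieldType) (gT : finGroupType) (G : {group gT}).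
Local Notation Om := (Omega k G).

(* The free A-module on the E_(a,b), with E_(a,b) E_(c,d) = c_(b,c) E_(a,d)
   extended bilinearly. As the E_(a,b) form a Z-basis of J_G, this is J_G for
   A = int, and A (x)_Z J_G in general. *)
Definition JG (A : comNzRingType) : Type := {ffun Om * Om -> A^o}.
HB.instance Definition _ A := GRing.Lmodule.on (JG A).

Definition JE (A : comNzRingType) (a b : Om) : JG A :=
  [ffun p => (p == (a, b))%:R].

Definition JGmul (A : comNzRingType) (X Y : JG A) : JG A :=
  \sum_p \sum_q (X p * Y q * (fun_rank p.2 q.1)%:R) *: JE A p.1 q.2.

Lemma JGmulE (A : comNzRingType) (a b c d : Om) :
  JGmul (JE A a b) (JE A c d) = (fun_rank b c)%:R *: JE A a d.
Proof.
have E1 x y : JE A x y (x, y) = 1 by rewrite ffunE eqxx.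
have E0 x y p : p != (x, y) -> JE A x y p = 0 by rewrite ffunE => /negPf->.
rewrite /JGmul (bigD1 (a, b)) //= [X in _ + X]big1 => [|p np].
  rewrite addr0 (bigD1 (c, d)) //= [X in _ + X]big1 => [|q nq].
    by rewrite addr0 !E1 !mul1r.
  by rewrite (E0 _ _ _ nq) mulr0 mul0r scale0r.
by rewrite big1 // => q _; rewrite (E0 _ _ _ np) !mul0r scale0r.
Qed.

Variable F : fieldType.
HB.instance Definition _ := Vector.on (JG F).

Definition VG : Type := {ffun Om -> F^o}.
HB.instance Definition _ := Vector.on VG.

Definition nG : nat := #|{: Om}|.

Definition CG : 'M[F]_nG :=
  \matrix_(i, j) (fun_rank (enum_val i : Om) (enum_val j : Om))%:R.

Definition cG (v w : VG) : F := \sum_b \sum_c v b * (fun_rank b c)%:R * w c.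

Definition KG : set VG := [set v | forall w, cG v w = 0]%classic.

(* v (x) w, under the identification of V_G (x) V_G with J_G that sends
   a (x) b to E_(a,b). *)
Definition tens (v w : VG) : JG F := [ffun p => v p.1 * w p.2].

(* The subspace U (x) W of V_G (x) V_G, for subspaces U and W of V_G. *)
Definition tens_sub (U W : set VG) : set (JG F) :=
  [set X | exists (m : nat) (u w : 'I_m -> VG),
     [/\ forall i, U (u i), forall i, W (w i) &
         X = \sum_i tens (u i) (w i)]]%classic.

Definition JG_mx (X : JG F) : 'M[F]_nG :=
  \matrix_(i, j) X (enum_val i : Om, enum_val j : Om).

Lemma JG_mxE (a b : Om) : JG_mx (JE F a b) = delta_mx (enum_rank a) (enum_rank b).
Proof.
apply/matrixP => i j; rewrite !mxE ffunE xpair_eqE.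
by rewrite -(inj_eq enum_rank_inj) -[X in _ && X](inj_eq enum_rank_inj) !enum_valK.
Qed.

Lemma JG_mxM (X Y : JG F) : JG_mx (JGmul X Y) = JG_mx X *m CG *m JG_mx Y.
Proof.
have E1 x y : JE F x y (x, y) = 1 by rewrite ffunE eqxx.
have E0 x y p : p != (x, y) -> JE F x y p = 0 by rewrite ffunE => /negPf->.
have bijv := onW_bij xpredT (@enum_val_bij Om).
apply/matrixP => i j; rewrite !mxE /JGmul sum_ffunE.
set i' : Om := enum_val i; set j' : Om := enum_val j.
transitivity (\sum_b \sum_c X (i', b) * (fun_rank b c)%:R * Y (c, j')).
  pose T a b :=
    (\sum_q (X (a, b) * Y q * (fun_rank b q.1)%:R) *: JE F a q.2) (i', j').
  transitivity (\sum_p T p.1 p.2); first by apply: eq_bigr => -[].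
  rewrite -(pair_bigA _ T) /T /=.
  rewrite (bigD1 i') //= [X in _ + X]big1 => [|a na]; last first.
    apply: big1 => b _; rewrite sum_ffunE big1 // => q _.
    by rewrite ffunE E0 ?scaler0 // xpair_eqE eq_sym (negPf na).
  rewrite addr0; apply: eq_bigr => b _; rewrite sum_ffunE.
  pose S c d := ((X (i', b) * Y (c, d) * (fun_rank b c)%:R) *: JE F i' d) (i', j').
  transitivity (\sum_q S q.1 q.2); first by apply: eq_bigr => -[].
  rewrite -(pair_bigA _ S) /S /=.
  apply: eq_bigr => c _; rewrite (bigD1 j') //= big1 => [|d nd].
    by rewrite addr0 ffunE E1 mulrAC; apply: mulr1.
  by rewrite ffunE E0 ?scaler0 // xpair_eqE [j' == d]eq_sym (negPf nd) andbF.
rewrite exchange_big (reindex _ bijv) /=; apply: eq_bigr => l _.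
rewrite mxE mulr_suml (reindex _ bijv) /=; apply: eq_bigr => m _.
by rewrite !mxE.
Qed.

End JG.

Arguments JGmul {k gT G A} X Y.
Arguments nG k {gT} G.
Arguments CG k {gT} G F.
Arguments KG k {gT} G F _.
Arguments tens_sub {k gT G F} U W _.

Section NonUnitalAlgebra.
Variables (F : fieldType) (V : vectType F) (mul : V -> V -> V).

Definition two_sided_ideal (I : {vspace V}) : Prop :=
  forall x y, x \in I -> mul x y \in I /\ mul y x \in I.

(* I^(m+1) = 0 for some m. *)
Definition nilpotent_sub (I : {vspace V}) : Prop :=
  exists m : nat, forall (x : V) (s : seq V),
    size s = m -> x \in I -> all (mem I) s -> foldl mul x s = 0.

(* The Jacobson radical, as the largest nilpotent two-sided ideal. *)
Definition is_jacobson (I : {vspace V}) : Prop :=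
  [/\ two_sided_ideal I, nilpotent_sub I &
      forall I' : {vspace V}, two_sided_ideal I' -> nilpotent_sub I' ->
        (I' <= I)%VS].

Definition quot_pi (I : {vspace V}) : V -> {ideal_quot pred_of_vspace I} :=
  (\pi_{ideal_quot pred_of_vspace I})%qT.

(* V / I is isomorphic to Mat_r(F) as an algebra: the operations of V / I are
   those that make the projection quot_pi I a morphism. *)
Definition quot_iso_mx (I : {vspace V}) (r : nat) : Prop :=
  exists psi : {ideal_quot pred_of_vspace I} -> 'M[F]_r,
    [/\ bijective psi,
        forall x y, psi (quot_pi I (x + y)) = psi (quot_pi I x) + psi (quot_pi I y),
        forall (c : F) x, psi (quot_pi I (c *: x)) = c *: psi (quot_pi I x) &
        forall x y,
          psi (quot_pi I (mul x y)) = psi (quot_pi I x) *m psi (quot_pi I y)].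

End NonUnitalAlgebra.

(* Main.v *)
(* Let C be the matrix of the ranks c_(b,c), so that J_G is Mat_n with product
   X C Y. The set {X | C X C = 0} is an ideal whose cube is zero; an ideal
   containing some X with C X C != 0 contains every matrix unit E_(a,b), and
   E_(a,b)^2 = c_(b,a) E_(a,b) is not nilpotent when c_(b,a) != 0. If C = L R is
   a full rank factorization, X |-> R X L is a surjective morphism onto Mat_r
   with kernel {X | C X C = 0}. Finally, if C D C = C, then
   X = (1 - D C) X + D C X (1 - C D) + D (C X C) D exhibits every X with
   C X C = 0 as an element of K (x) V + V (x) K.

   This last step uses that C is symmetric, as K is the left kernel of C. The
   summand of c_(b,c) at a double coset D and that of c_(c,b) at D^-1 count the
   irreducible representations of two twisted group algebras that are opposite
   to each other, and transposition matches these. *)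
From HB Require Import structures.
Require Import Defs.
From mathcomp Require Import all_boot all_order all_algebra all_fingroup.
From mathcomp Require Import finmap boolp classical_sets cardinality reals complex ring.
Set Implicit Arguments.
Unset Strict Implicit.
Unset Printing Implicit Defensive.
Import GRing.Theory.
Local Open Scope ring_scope.

(** * Irreducible representations of an algebra and of its opposite *)

Lemma card_eq_fset_set (S T : choiceType) (A : set S) (B : set T) :
  (A #= B)%card -> #|` fset_set A|%fset = #|` fset_set B|%fset.
Proof.
move=> AB; have [fA|nfA] := pselect (finite_set A).
  have [n An] := fA; rewrite (card_fset_set An).
  by apply/esym/card_fset_set; rewrite -(card_eql AB).
(* Infinite case: [fset_set] is empty on both sides. *)
rewrite /fset_set; case: pselect => // _; case: pselect => // -[n Bn].
by case: nfA; exists n; rewrite (card_eql AB).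
Qed.

Section OppositeIrr.
Variables (k : fieldType) (A B : algType k).
Variables (phi : {linear A -> B}) (psi : B -> A).
Hypotheses (phiK : cancel phi psi) (psiK : cancel psi phi).
Hypothesis phiM : forall a b, phi (a * b) = phi b * phi a.

Lemma antimorph1 : phi 1 = 1.
Proof. by rewrite -[LHS]mul1r -{1}[1]psiK -phiM mul1r psiK. Qed.

(** The dual representation: transposition and [phi] both reverse products, so their composite
    preserves them. *)
Definition tr_rep_fun (rho : mxrep B) (a : A) : 'M[k]_((projT1 rho).+1) :=
  (projT2 rho (phi a))^T.

Section TrRep.
Variable rho : mxrep B.

Fact tr_rep_linear : linear (tr_rep_fun rho).
Proof. by move=> c a b; rewrite /tr_rep_fun !linearP. Qed.

Fact tr_rep_mul : monoid_morphism (tr_rep_fun rho).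
Proof.
split=> [|a b]; first by rewrite /tr_rep_fun antimorph1 rmorph1 trmx1.
by rewrite /tr_rep_fun phiM rmorphM; apply: trmx_mul.
Qed.

HB.instance Definition _ :=
  GRing.isLinear.Build k A 'M[k]_((projT1 rho).+1) *:%R (tr_rep_fun rho) tr_rep_linear.
HB.instance Definition _ :=
  GRing.isMonoidMorphism.Build A 'M[k]_((projT1 rho).+1) (tr_rep_fun rho) tr_rep_mul.

Definition tr_rep : mxrep A :=
  existT _ (projT1 rho) (tr_rep_fun rho : {lrmorphism A -> 'M[k]_((projT1 rho).+1)}).

End TrRep.

Lemma tr_rep_iso (rho sigma : mxrep B) :
  mxrep_iso rho sigma -> mxrep_iso (tr_rep rho) (tr_rep sigma).
Proof.
(* Transposition turns intertwiners around, so it is the transpose of the inverse [Q] that goes from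
   [tr_rep rho] to [tr_rep sigma]. *)
case=> P [Q [PQ QP Prho]]; exists Q^T, P^T; split.
- by rewrite -trmx_mul PQ trmx1.
- by rewrite -trmx_mul QP trmx1.
move=> a /=; rewrite /tr_rep_fun -!trmx_mul; congr trmx.
by rewrite -[LHS]mul1mx -QP -mulmxA (mulmxA P) Prho -!mulmxA PQ mulmx1.
Qed.

(* A subspace U stable under the transposed action has an annihilator that is
   stable under the original one. *)
Lemma tr_rep_irr (rho : mxrep B) : mxrep_irr rho -> mxrep_irr (tr_rep rho).
Proof.
move=> irr U /= Ust; set n := (projT1 rho).+1.
(* The rows of [M] form a basis of [U], so its kernel [W] is the annihilator of [U]. *)
pose M : 'M[k]_(\dim U, n) := \matrix_(i, j) (vbasis U)`_i j 0.
have MP (w : 'cV[k]_n) :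
    reflect (forall u, u \in U -> u^T *m w = 0) (M *m w == 0).
  apply: (iffP eqP) => [Mw u uU|Uw].
    rewrite (coord_vbasis uU) linear_sum /= mulmx_suml big1 // => i _.
    rewrite linearZ /= -scalemxAl; suff -> : ((vbasis U)`_i)^T = row i M.
      by rewrite -row_mul Mw row0 scaler0.
    by apply/rowP => j; rewrite !mxE.
  apply/row_matrixP => i; rewrite row_mul row0.
  rewrite -[RHS](Uw (vbasis U)`_i) ?vbasis_mem ?mem_nth ?size_tuple //.
  by congr (_ *m w); apply/rowP => j; rewrite !mxE.
pose f : {linear 'cV[k]_n -> 'cV[k]_(\dim U)} := mulmx M.
pose W := lker (linfun f).
have WP w : reflect (forall u, u \in U -> u^T *m w = 0) (w \in W).
  by rewrite memv_ker lfunE; apply: MP.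
have [b w /WP Ww|W0|WT] := irr W.
- apply/WP => u uU; rewrite mulmxA.
  rewrite -[u^T *m _]trmxK trmx_mul trmxK; apply: Ww.
  by have := Ust (psi b) u uU; rewrite /tr_rep_fun psiK.
- right; apply/eqP; rewrite eqEdim subvf dimvf dim_matrix /=.
  rewrite -[X in (X <= _)%N]/(n * 1)%N muln1 leqNgt.
  (* If dim U < n, the fewer than n equations that define [W] have a nonzero common solution,
     against [W0]. *)
  apply/negP => lt_n.
  have : kermx M^T != 0.
    by rewrite kermx_eq0 -row_leq_rank -ltnNge (leq_ltn_trans (rank_leq_col _)).
  case/matrix0Pn => i [j ij].
  have : (row i (kermx M^T))^T \in W.
    by rewrite memv_ker lfunE /= -[_ *m _]trmxK trmx_mul trmxK -row_mul
      mulmx_ker row0 trmx0.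
  rewrite W0 memv0 => /eqP/matrixP/(_ j 0).
  rewrite [LHS]mxE [LHS]mxE [RHS]mxE => /eqP.
  by rewrite (negPf ij).
left; apply/eqP; rewrite -subv0; apply/subvP => u uU; rewrite memv0.
apply/eqP/matrixP => i j; rewrite ord1 mxE.
have /WP/(_ u uU) : delta_mx i 0 \in W by rewrite WT memvf.
by rewrite -colE => /matrixP/(_ 0 0); rewrite !mxE.
Qed.

End OppositeIrr.

Section OppositeNumber.
Variables (k : fieldType).

Lemma mxrep_iso_sym (A : algType k) (rho sigma : mxrep A) :
  mxrep_iso rho sigma -> mxrep_iso sigma rho.
Proof.
case=> P [Q [PQ QP Prho]]; exists Q, P; split=> // a.
by rewrite -[LHS]mulmx1 -PQ mulmxA -(mulmxA Q) -Prho mulmxA QP mul1mx.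
Qed.

Lemma mxrep_iso_trans (A : algType k) (rho sigma tau : mxrep A) :
  mxrep_iso rho sigma -> mxrep_iso sigma tau -> mxrep_iso rho tau.
Proof.
case=> P [Q [PQ QP E]] [P' [Q' [PQ' QP' E']]]; exists (P' *m P), (Q *m Q'); split.
- by rewrite mulmxA -(mulmxA P') PQ mulmx1.
- by rewrite mulmxA -(mulmxA Q) QP' mulmx1.
by move=> a; rewrite -mulmxA E mulmxA E' mulmxA.
Qed.

Lemma mxrep_iso_eq (A : algType k) (n : nat) (rho sigma : {lrmorphism A -> 'M[k]_n.+1}) :
  rho =1 sigma -> mxrep_iso (existT _ n rho) (existT _ n sigma).
Proof.
by move=> E; exists 1%:M, 1%:M; split=> [||a]; rewrite ?mulmx1 //= mul1mx E.
Qed.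

(** The two dualizations [F] and [G] are mutually inverse only up to isomorphism, but the preimage
    under [F] of an isomorphism class is exactly an isomorphism class, that of the dual under [G].
    Taking preimages is thus a bijection from [Irr A] to [Irr B]. *)
Lemma nIrr_opp (A B : algType k) (phi : {linear A -> B}) (psi : {linear B -> A})
    (phiK : cancel phi psi) (psiK : cancel psi phi)
    (phiM : forall a b, phi (a * b) = phi b * phi a) : nIrr A = nIrr B.
Proof.
have psiM a b : psi (a * b) = psi b * psi a.
  by apply: (can_inj phiK); rewrite phiM !psiK.
pose F := tr_rep psiK phiM; pose G := tr_rep phiK psiM.
have FG rho : mxrep_iso (F (G rho)) rho.
  case: rho => n rho; apply: mxrep_iso_eq => a.
  by rewrite /= /tr_rep_fun /= /tr_rep_fun phiK trmxK.
have GF rho : mxrep_iso (G (F rho)) rho.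
  case: rho => n rho; apply: mxrep_iso_eq => a.
  by rewrite /= /tr_rep_fun /= /tr_rep_fun psiK trmxK.
have cls rho : (F @^-1` [set s | mxrep_iso rho s] = [set s | mxrep_iso (G rho) s])%classic.
  apply/seteqP; split=> s /=.
    by move=> /(tr_rep_iso phiK psiM) h; apply: mxrep_iso_trans (GF s).
  by move=> /(tr_rep_iso psiK phiM); apply/mxrep_iso_trans/mxrep_iso_sym/FG.
rewrite /nIrr; apply: card_eq_fset_set; rewrite card_eq_sym.
have -> : @Irr _ B = ((fun S => F @^-1` S) @` @Irr _ A)%classic.
  apply/seteqP; split=> S.
    case=> rho irr <-; exists [set s | mxrep_iso (F rho) s]%classic.
      by exists (F rho) => //; apply: tr_rep_irr.
    rewrite cls; apply/seteqP; split=> s /=; apply: mxrep_iso_trans => //.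
    exact/mxrep_iso_sym/GF.
  case=> _ [rho irr <-] <-; exists (G rho); last by rewrite cls.
  exact: tr_rep_irr.
apply: inj_card_eq => S T /set_mem[rho _ <-] /set_mem[sigma _ <-]; rewrite !cls => E.
have : mxrep_iso (G rho) (G sigma).
  suff: [set s | mxrep_iso (G rho) s]%classic (G sigma) by [].
  rewrite E /=; apply: (mxrep_iso_trans (sigma := G (F (G sigma)))).
    exact/mxrep_iso_sym/GF.
  exact: GF.
move=> /(tr_rep_iso psiK phiM) h.
have rs : mxrep_iso rho sigma.
  exact: mxrep_iso_trans (mxrep_iso_sym (FG rho)) (mxrep_iso_trans h (FG sigma)).
apply/seteqP; split=> s /=; apply: mxrep_iso_trans => //.
exact: mxrep_iso_sym.
Qed.

End OppositeNumber.

(** * Anti-isomorphisms of twisted group algebras *)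

Section OppositeTwistedAlgebra.
Variables (k : fieldType) (gT : finGroupType) (L M : {group gT}).
Variables (th : cocycle k L) (th' : cocycle k M).
Variables (f : [subg L] -> [subg M]) (g : [subg M] -> [subg L]).
Variable l : [subg L] -> k.
Hypotheses (fK : cancel f g) (gK : cancel g f).
Hypothesis fM : forall x y, f (x * y)%g = (f y * f x)%g.
Hypothesis l0 : forall x, l x != 0.
Hypothesis lM : forall x y,
  val th (sgval x, sgval y) * l (x * y)%g =
  l x * l y * val th' (sgval (f y), sgval (f x)).

(** On basis elements this is u_x |-> l(x) u_(f x); [lM] says that it reverses the product u_x
    u_y. *)
Definition twopp (a : twalg th) : twalg th' := [ffun z => a (g z) * l (g z)].
Definition twopp_inv (b : twalg th') : twalg th := [ffun x => b (f x) / l x].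

Fact twopp_linear : linear twopp.
Proof.
by move=> c a b; apply/ffunP => z; rewrite !ffunE mulrDl -[_ *: _ * _]mulrA.
Qed.

Fact twopp_inv_linear : linear twopp_inv.
Proof.
by move=> c a b; apply/ffunP => z; rewrite !ffunE mulrDl -[_ *: _ * _]mulrA.
Qed.

HB.instance Definition _ :=
  GRing.isLinear.Build k (twalg th) (twalg th') *:%R twopp twopp_linear.
HB.instance Definition _ :=
  GRing.isLinear.Build k (twalg th') (twalg th) *:%R twopp_inv twopp_inv_linear.

Fact twoppK : cancel twopp twopp_inv.
Proof. by move=> a; apply/ffunP => x; rewrite !ffunE fK mulfK. Qed.

Fact twopp_invK : cancel twopp_inv twopp.
Proof. by move=> b; apply/ffunP => z; rewrite !ffunE gK divfK. Qed.

Fact twoppM (a b : twalg th) : twopp (a * b) = twopp b * twopp a.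
Proof.
apply/ffunP => z; rewrite -[z]gK; move: (g z) => {}z.
(* For z = x y one has f z = f y f x, so the term of x on the left matches the term of f y = f (x^-1
   z) on the right. *)
rewrite !ffunE fK mulr_suml [RHS](reindex (fun x => f (x^-1 * z)%g)) /=; last first.
  exists (fun w => z * (g w)^-1)%g => w _; first by rewrite fK invMg invgK mulKVg.
  by rewrite invMg invgK mulgKV gK.
apply: eq_bigr => x _; set y := (x^-1 * z)%g.
have zE : z = (x * y)%g by rewrite mulKVg.
rewrite !ffunE !fK -[((sgval x)^-1 * _)%g]/(sgval y).
rewrite -[((sgval (f y))^-1 * _)%g]/(sgval ((f y)^-1 * f z)%g).
have -> : ((f y)^-1 * f z = f x)%g by rewrite zE fM mulKg.
by rewrite fK {1}zE -!mulrA lM; ring.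
Qed.

Lemma nIrr_twalg_opp : nIrr (twalg th) = nIrr (twalg th').
Proof. exact: (nIrr_opp twoppK twopp_invK twoppM). Qed.

End OppositeTwistedAlgebra.

(** * Symmetry of the ranks c_(b,c) *)

Section FunRankSymmetric.
Variables (k : closedFieldType) (gT : finGroupType) (G : {group gT}).

(* In k_a[H], u_h^-1 u_x^-1 u_h is a scalar multiple of the basis element at
   (x^-1)^h, and x |-> u_h^-1 u_x^-1 u_h reverses products; l collects the
   scalars. *)
Lemma cocycle_conj_opp (H : {group gT}) (a : cochain k gT) (h : gT) :
  is_cocycle H a -> h \in H ->
  exists2 l : gT -> k, (forall x, x \in H -> l x != 0) &
    forall x y, x \in H -> y \in H ->
      l (x * y)%g = a (x, y) * l x * l y * a ((y^-1) ^ h, (x^-1) ^ h)%g.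
Proof.
move=> /is_cocycleP[a0 aA] hH.
(* These are the scalars in u_h^-1 u_x u_h = m(x) u_(x^h) and u_x^-1 = c(x) u_(x^-1). The factor
   a(1,1) in [c] appears because the unit is a(1,1)^-1 u_1. *)
pose m (x : gT) := a (x, h) / a (h, x ^ h)%g.
pose c (x : gT) := (a (x, x^-1)%g * a (1, 1)%g)^-1.
have m0 x : x \in H -> m x != 0.
  by move=> xH; rewrite mulf_neq0 ?invr_eq0 ?a0 ?groupJ.
have c0 x : x \in H -> c x != 0.
  by move=> xH; rewrite invr_eq0 mulf_neq0 ?a0 ?groupV.
(* Conjugation by u_h is multiplicative: the three cocycle identities move u_h from the right of u_x
   u_y to its left. *)
have mM x y : x \in H -> y \in H ->
    m x * m y * a (x ^ h, y ^ h)%g = a (x, y) * m (x * y)%g.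
  move=> xH yH; have xhH := groupJ xH hH; have yhH := groupJ yH hH.
  have e1 := aA _ _ _ xH yH hH.
  have e2 := aA _ _ _ xH hH yhH.
  have e3 := aA _ _ _ hH xhH yhH.
  rewrite -conjgC in e2; rewrite -conjgC in e3; rewrite /m conjMg.
  have n1 := a0 _ _ hH xhH; have n2 := a0 _ _ hH yhH.
  have n3 := a0 _ _ hH (groupM xhH yhH).
  have -> : a ((x * y)%g, h) = a (y, h) * a (x, (y * h)%g) / a (x, y).
    by rewrite e1 mulfK // a0.
  have -> : a (x, (y * h)%g) = a ((x * h)%g, (y ^ h)%g) * a (x, h) / a (h, (y ^ h)%g).
    by rewrite -e2 mulrC mulKf.
  have E : a ((x ^ h)%g, (y ^ h)%g) =
      a ((x * h)%g, (y ^ h)%g) * a (h, (x ^ h)%g) / a (h, (x ^ h * y ^ h)%g).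
    by rewrite -e3 mulfK.
  rewrite E; field.
  by rewrite n1 n2 n3 a0.
(* This is (u_x u_y)^-1 = u_y^-1 u_x^-1 in coordinates. *)
have cM x y : x \in H -> y \in H ->
    c (x * y)%g = a (x, y) * c x * c y * a (y^-1, x^-1)%g.
  move=> xH yH.
  have xV : x^-1%g \in H by rewrite groupV.
  have yV : y^-1%g \in H by rewrite groupV.
  have e1 := aA _ _ _ xH yH (groupM yV xV); rewrite mulKVg in e1.
  have e2 := aA _ _ _ yH yV xV; rewrite mulgV in e2.
  have e3 := aA _ _ _ (group1 H) (group1 H) xV; rewrite mulg1 mul1g in e3.
  have e4 : a (1, x^-1)%g = a (1, 1)%g by apply: mulfI e3; apply: a0.
  have nz u v (uH : u \in H) (vH : v \in H) := a0 u v uH vH.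
  have -> : a (y^-1, x^-1)%g = a (1, 1)%g * a (y, y^-1)%g / a (y, (y^-1 * x^-1)%g).
    by rewrite -e4 -e2 mulfK ?nz ?groupM.
  rewrite /c invMg.
  have -> : a ((x * y)%g, (y^-1 * x^-1)%g) =
      a (y, (y^-1 * x^-1)%g) * a (x, x^-1%g) / a (x, y) by rewrite e1 mulfK ?nz.
  by field; rewrite !nz ?groupM.
exists (fun x => c x * m x^-1%g) => [x xH|x y xH yH].
  by rewrite mulf_neq0 ?c0 ?m0 ?groupV.
rewrite cM // invMg.
transitivity (a (x, y) * c x * c y * (a (y^-1, x^-1)%g * m (y^-1 * x^-1)%g)).
  by rewrite !mulrA.
by rewrite -mM ?groupV //; ring.
Qed.

(** The hypotheses place g' in the double coset K g^-1 H, inverse to H g K. Conjugation by t = g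
    l0^-1 carries H :&: g K g^-1 onto K :&: g' H g'^-1, because l0 is in K and t g' = h is in H;
    composed with inversion it reverses products. *)
Lemma nIrr_theta_opp (p q : twpair k G) (g g' h : gT) :
  h \in tw_grp p -> (g' * h^-1 * g)%g \in tw_grp q ->
  nIrr (twalg (theta p q g)) = nIrr (twalg (theta q p g')).
Proof.
set H := tw_grp p; set K := tw_grp q; set l0 := (g' * _ * g)%g => hH l0K.
set L := (H :&: K :^ g^-1)%G; set M := (K :&: H :^ g'^-1)%G.
pose t := (g * l0^-1)%g.
have tg : (t * g' = h)%g by rewrite /t /l0 !invMg !invgK !mulgA mulgV mul1g mulgKV.
have LM x : (x ^ t \in M)%g = (x \in L).
  rewrite !inE !mem_conjgV -conjgM tg (groupJr _ hH) {1}/t conjgM.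
  by rewrite (groupJr (x ^ g)%g) ?groupV // andbC.
pose f (x : [subg L]) : [subg M] := subg M ((sgval x)^-1 ^ t)%g.
pose f' (z : [subg M]) : [subg L] := subg L ((sgval z)^-1 ^ t^-1)%g.
have fE x : sgval (f x) = ((sgval x)^-1 ^ t)%g.
  by apply: subgK; rewrite LM groupV; apply: subgP.
have f'E z : sgval (f' z) = ((sgval z)^-1 ^ t^-1)%g.
  by apply: subgK; rewrite -LM conjgKV groupV; apply: subgP.
have [la la0 laM] := cocycle_conj_opp (tw_cocycle p) hH.
have l0V : l0^-1%g \in K by rewrite groupV.
have [lb lb0 lbM] := cocycle_conj_opp (tw_cocycle q) l0V.
(* As x^t is x^g conjugated by l0^-1, [lb] is taken at x^g. A quotient appears because [theta_fun]
   has the cochain of [p] inverted and that of [q] not. *)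
pose l (x : [subg L]) := la (sgval x) / lb (sgval x ^ g)%g.
have LP (x : [subg L]) : sgval x \in H /\ (sgval x ^ g)%g \in K.
  by apply/andP; have := subgP x; rewrite inE mem_conjgV.
apply: (@nIrr_twalg_opp _ _ _ _ _ _ f f' l) => [x|z|x y|x|x y].
- by apply: val_inj; rewrite /= f'E fE conjVg conjgK invgK.
- by apply: val_inj; rewrite /= fE f'E conjVg conjgKV invgK.
- by apply: val_inj; rewrite /= !fE /= invMg conjMg.
- by have [xH xK] := LP x; rewrite mulf_neq0 ?invr_eq0 ?la0 ?lb0.
have [xH xK] := LP x; have [yH yK] := LP y.
rewrite /l /= conjMg laM // lbM // !ffunE /= !fE -!conjgM tg -!conjVg /t !conjgM.
set u := tw_cochain p _; set v := tw_cochain q (_, _).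
set u' := tw_cochain p _; set v' := tw_cochain q _.
have u0 : u != 0 by have /is_cocycleP[+ _] := tw_cocycle p; apply.
have v0 : v != 0 by have /is_cocycleP[+ _] := tw_cocycle q; apply.
have v'0 : v' != 0.
  by have /is_cocycleP[+ _] := tw_cocycle q; apply; rewrite groupJ // conjVg groupV.
by field; rewrite u0 v0 v'0 !lb0.
Qed.

(** D |-> D^-1 matches the double cosets. The representative chosen in D^-1 can differ from the
    inverse of the one chosen in D, and the elements of H and K in [nIrr_theta_opp] absorb this
    difference. *)
Lemma fun_rankC (b c : Omega k G) : fun_rank b c = fun_rank c b.
Proof.
rewrite /fun_rank; set p := Omega_repr b; set q := Omega_repr c.
have inv (H K : {group gT}) (D : {set gT}) : D \in dcosets G H K -> (D^-1)%g \in dcosets G K H.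
  case/imsetP=> g gG ->; apply/imsetP; exists g^-1%g; first by rewrite groupV.
  by rewrite !invMg !invGid invg_set1 mulgA.
rewrite [RHS](reindex_inj invg_inj) /=.
apply: eq_big => [D|D DP].
  by apply/idP/idP => /inv //; rewrite invgK.
have [g gG DE] := imsetP DP.
have DP2 x : x \in D -> exists2 h, h \in tw_grp p & exists2 l, l \in tw_grp q & x = (h * g * l)%g.
  rewrite DE => /mulsgP[_ l /rcosetP[h hH ->] lK ->].
  by exists h => //; exists l.
have gD : g \in D.
  by rewrite DE -[g]mulg1 mem_mulg ?group1 // mulg1 rcoset_refl.
have [h1 h1H [k1 k1K E1]] := DP2 _ (mem_repr _ gD).
have : (fingroup.repr D^-1)^-1%g \in D.
  by rewrite -mem_invg (mem_repr g^-1%g) // mem_invg invgK.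
case/DP2 => [h2 h2H [k2 k2K E2]].
(* This choice cancels the H-parts of the two representatives, leaving k2^-1 k1 in K. *)
apply: (@nIrr_theta_opp _ _ _ _ (h1 * h2^-1)%g); first by rewrite groupM ?groupV.
rewrite -[fingroup.repr _]invgK E2 E1 !invMg !invgK !mulgA !mulgKV.
by rewrite groupM ?groupV.
Qed.
End FunRankSymmetric.

(** * Matrix form of J_G, and K (x) V + V (x) K *)

Lemma mulmx_full_free_eq0 (F : fieldType) m p q r (L : 'M[F]_(m, p)) (M : 'M_(p, q))
    (R : 'M_(q, r)) : row_full L -> row_free R -> L *m M *m R = 0 -> M = 0.
Proof.
move=> /row_fullP[L' L'L] /row_freeP[R' RR'] E.
by rewrite -[M]mul1mx -L'L -[LHS]mulmx1 -RR' mulmxA -(mulmxA L') -(mulmxA L')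
  E mulmx0 mul0mx.
Qed.

Lemma mulmx_free_full_surj (F : fieldType) m p q r (R : 'M[F]_(m, p))
    (L : 'M[F]_(q, r)) (M : 'M_(m, r)) :
  row_free R -> row_full L -> exists N, R *m N *m L = M.
Proof.
move=> /row_freeP[R' RR'] /row_fullP[L' L'L]; exists (R' *m M *m L').
by rewrite !mulmxA RR' mul1mx -mulmxA L'L mulmx1.
Qed.

Section Radical.
Variables (k : closedFieldType) (gT : finGroupType) (G : {group gT}) (F : fieldType).
Local Notation Om := (Omega k G).
Local Notation n := (nG k G).
Local Notation J := (JG k G F).
Local Notation C := (CG k G F).
Local Notation r := (\rank C).

Definition mx_JG (M : 'M[F]_n) : J := [ffun p => M (enum_rank p.1) (enum_rank p.2)].

Lemma JG_mxK : cancel (@JG_mx k gT G F) mx_JG.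
Proof. by move=> X; apply/ffunP => -[a b]; rewrite !ffunE mxE !enum_rankK. Qed.

Lemma mx_JGK : cancel mx_JG (@JG_mx k gT G F).
Proof. by move=> M; apply/matrixP => i j; rewrite mxE ffunE !enum_valK. Qed.

Fact JG_mx_linear : linear (@JG_mx k gT G F).
Proof. by move=> c X Y; apply/matrixP => i j; rewrite !mxE !ffunE. Qed.

HB.instance Definition _ :=
  GRing.isLinear.Build F J 'M[F]_n *:%R (@JG_mx k gT G F) JG_mx_linear.

Lemma CG_tr : C^T = C.
Proof. by apply/matrixP => i j; rewrite !mxE fun_rankC. Qed.

Definition VG_col (v : VG k G F) : 'cV[F]_n := \col_i v (enum_val i).

(** [KG] is the left kernel of C; [fun_rankC] makes it the right kernel. Testing against basis
    vectors w gives the direct implication. *)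
Lemma KGP (v : VG k G F) : KG k G F v <-> C *m VG_col v = 0.
Proof.
have bijv := onW_bij xpredT (@enum_val_bij Om).
have E c : \sum_b v b * (fun_rank b c)%:R = (C *m VG_col v) (enum_rank c) 0.
  rewrite mxE (reindex _ bijv) /=; apply: eq_bigr => i _.
  by rewrite !mxE enum_rankK fun_rankC mulrC.
split=> [Kv|Cv w]; last first.
  rewrite /cG exchange_big big1 // => c _.
  by rewrite -mulr_suml E Cv mxE mul0r.
apply/colP => i; rewrite -(enum_valK i) -E mxE.
rewrite -[RHS](Kv [ffun c => (c == enum_val i)%:R]) /cG.
apply: eq_bigr => b _; rewrite (bigD1 (enum_val i)) //= big1 => [|c /negPf nc].
  by rewrite ffunE eqxx mulr1 addr0.
by rewrite ffunE nc mulr0.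
Qed.

Lemma JG_mx_tens (v w : VG k G F) : JG_mx (tens v w) = VG_col v *m (VG_col w)^T.
Proof.
by apply/matrixP => i j; rewrite !mxE big_ord_recl big_ord0 addr0 !mxE ffunE.
Qed.

Definition col_VG (u : 'cV[F]_n) : VG k G F := [ffun a => u (enum_rank a) 0].

Lemma col_VGK : cancel col_VG VG_col.
Proof. by move=> u; apply/colP => i; rewrite !mxE ffunE enum_valK. Qed.

Lemma tens_sub_KGP (X : J) :
  (exists Y Z, [/\ tens_sub (KG k G F) setT Y, tens_sub setT (KG k G F) Z & X = Y + Z])
  <-> C *m JG_mx X *m C = 0.
Proof.
split=> [[_ [_ [[p [u [w [uK _ ->]]]] [q [u' [w' [_ wK ->]]]] ->]]]|XC].
  rewrite linearD !linear_sum /= mulmxDr mulmxDl !mulmx_sumr !mulmx_suml.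
  rewrite !big1 ?addr0 // => i _; rewrite JG_mx_tens.
    have /KGP E := wK i; rewrite !mulmxA -[C in LHS]CG_tr -mulmxA -trmx_mul CG_tr.
    by rewrite E trmx0 mulmx0.
  by have /KGP E := uK i; rewrite mulmxA E !mul0mx.
pose D := pinvmx C.
have CDC : C *m D *m C = C by apply: mulmxKpV.
(* A matrix product is the sum of the outer products of columns of [A] with rows of [B], hence a
   finite sum of tensors. *)
have tensE (A B : 'M[F]_n) :
    mx_JG (A *m B) = \sum_i tens (col_VG (col i A)) (col_VG (row i B)^T).
  rewrite -[RHS]JG_mxK; congr mx_JG; rewrite linear_sum /=.
  apply/matrixP => i j; rewrite summxE mxE; apply: eq_bigr => l _.
  by rewrite JG_mx_tens !col_VGK trmxK mxE big_ord_recl big_ord0 addr0 !mxE.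
pose A := 1%:M - D *m C; pose B := 1%:M - C *m D.
(* So the columns of [A] lie in K, and by symmetry of C so do the transposed rows of any multiple Y
   B. *)
have CA : C *m A = 0 by rewrite mulmxBr mulmx1 mulmxA CDC subrr.
have BC : B *m C = 0 by rewrite mulmxBl mul1mx CDC subrr.
exists (mx_JG (A *m JG_mx X)), (mx_JG (D *m C *m JG_mx X *m B)); split.
- rewrite tensE; exists n; exists (fun i => col_VG (col i A)); eexists; split=> // i.
  by apply/KGP; rewrite col_VGK colE mulmxA CA mul0mx.
- rewrite tensE; exists n; eexists; exists (fun i => col_VG (row i B)^T); split=> // i.
  by apply/KGP; rewrite col_VGK -[C]CG_tr -trmx_mul -row_mul BC row0 trmx0.
rewrite -[LHS]JG_mxK -[RHS]JG_mxK; congr mx_JG.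
rewrite linearD /= !mx_JGK mulmxBl mul1mx mulmxBr mulmx1.
have -> : D *m C *m JG_mx X *m (C *m D) = D *m (C *m JG_mx X *m C) *m D.
  by rewrite !mulmxA.
by rewrite XC mulmx0 mul0mx subr0 subrK.
Qed.

(** * Reduction to Mat_r by a full rank factorization *)

Let Lc : 'M[F]_(n, r) := col_base C.
Let Rc : 'M[F]_(r, n) := row_base C.

Definition JG_red (X : J) : 'M[F]_r := Rc *m JG_mx X *m Lc.

Fact JG_red_linear : linear JG_red.
Proof.
by move=> c X Y; rewrite /JG_red linearP mulmxDr mulmxDl -scalemxAr -scalemxAl.
Qed.

HB.instance Definition _ :=
  GRing.isLinear.Build F J 'M[F]_r *:%R JG_red JG_red_linear.

Lemma JG_redM (X Y : J) : JG_red (JGmul X Y) = JG_red X *m JG_red Y.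
Proof.
rewrite /JG_red JG_mxM.
transitivity (Rc *m JG_mx X *m (Lc *m Rc) *m JG_mx Y *m Lc); last by rewrite !mulmxA.
by rewrite mulmx_base !mulmxA.
Qed.

(** C X C = L (R X L) R, where L has a left inverse and R a right inverse. *)
Lemma JG_red_eq0 (X : J) : (JG_red X == 0) = (C *m JG_mx X *m C == 0).
Proof.
have CE : C *m JG_mx X *m C = Lc *m JG_red X *m Rc.
  transitivity ((Lc *m Rc) *m JG_mx X *m (Lc *m Rc)); first by rewrite mulmx_base.
  by rewrite /JG_red !mulmxA.
rewrite CE; move: (JG_red X) => M; apply/eqP/eqP => [->|E]; first by rewrite mulmx0 mul0mx.
exact: (mulmx_full_free_eq0 (col_base_full C) (row_base_free C)).
Qed.

Lemma JG_red_surj (M : 'M[F]_r) : exists X : J, JG_red X = M.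
Proof.
have [N <-] := mulmx_free_full_surj M (row_base_free C) (col_base_full C).
by exists (mx_JG N); rewrite /JG_red mx_JGK.
Qed.

(** * The kernel of the reduction as Jacobson radical *)

Definition JG_rad : {vspace J} := lker (linfun JG_red).

Lemma JG_radE (X : J) : (X \in JG_rad) = (JG_red X == 0).
Proof. by rewrite memv_ker lfunE. Qed.

Lemma JG_radP (X : J) : reflect (C *m JG_mx X *m C = 0) (X \in JG_rad).
Proof. by rewrite JG_radE JG_red_eq0; apply: eqP. Qed.

Lemma dim_JG_rad : \dim JG_rad = (n ^ 2 - r ^ 2)%N.
Proof.
have := limg_ker_dim (linfun JG_red) fullv.
rewrite capfv -/JG_rad.
have -> : (linfun JG_red @: fullv = fullv)%VS.
  apply/eqP; rewrite eqEsubv subvf; apply/subvP => M _.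
  by have [X <-] := JG_red_surj M; rewrite -[JG_red X]lfunE memv_img ?memvf.
have dJ : \dim {:J} = (n ^ 2)%N.
  rewrite dimvf; transitivity (#|{: Om * Om}| * 1)%N; first by [].
  by rewrite muln1 card_prod mulnn.
by rewrite dJ dimvf dim_matrix => <-; rewrite -[(r ^ 2)%N]/(r * r)%N addnK.
Qed.

Lemma JG_rad_quot : quot_iso_mx JGmul JG_rad r.
Proof.
pose psi (q : {ideal_quot pred_of_vspace JG_rad}) : 'M[F]_r :=
  JG_red (generic_quotient.repr q).
(* Two representatives of a class differ by an element of the kernel of [JG_red]. *)
have psiE X : psi (quot_pi JG_rad X) = JG_red X.
  apply/eqP; rewrite -subr_eq0 -linearB /= -JG_radE.
  by rewrite Quotient.idealrBE /quot_pi reprK.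
exists psi; split=> [|X Y|c X|X Y]; rewrite ?psiE.
- have /boolp.choice[s sP] := JG_red_surj.
  exists (fun M => quot_pi JG_rad (s M)) => [q|M]; last by rewrite psiE sP.
  rewrite -[q]reprK; apply/eqP; rewrite -Quotient.idealrBE JG_radE linearB /=.
  by rewrite sP -/(quot_pi _ _) psiE subrr.
- by rewrite linearD.
- by rewrite linearZ.
- by rewrite JG_redM.
Qed.

Lemma JG_rad_jacobson : is_jacobson JGmul JG_rad.
Proof.
split=> [X Y /JG_radP XC||I Iid Inil].
- split; apply/JG_radP; rewrite JG_mxM; first by rewrite !mulmxA XC !mul0mx.
  transitivity (C *m JG_mx Y *m (C *m JG_mx X *m C)); first by rewrite !mulmxA.
  by rewrite XC mulmx0.
(* The exponent 2 stands for products of three factors, X C Y C Z, which contain C Y C = 0. *)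
- exists 2%N => X [|Y [|Z []]] //= _ _ /and3P[/JG_radP YC _ _].
  rewrite -[LHS]JG_mxK -[RHS]JG_mxK; congr mx_JG; rewrite !JG_mxM.
  transitivity (JG_mx X *m (C *m JG_mx Y *m C) *m JG_mx Z); first by rewrite !mulmxA.
  by rewrite YC mulmx0 mul0mx linear0.
apply/subvP => X XI; apply/JG_radP/eqP; apply/contraT => /matrix0Pn[i [j sij]].
set s := (_ *m _) i j in sij.
have [b [a cba]] : exists b a, C b a != 0.
  apply/matrix0Pn; apply: contraNneq sij => C0.
  by rewrite /s C0 mulmx0 mxE.
pose E := mx_JG (delta_mx a b).
have EI : E \in I.
  have [_ h1] := Iid _ (mx_JG (delta_mx a i)) XI.
  have [h2 _] := Iid _ (mx_JG (delta_mx j b)) h1.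
  (* E_(a,i) C X C E_(j,b) = s E_(a,b), where s is the (i,j) entry of C X C. *)
  suff -> : E = s^-1 *: JGmul (JGmul (mx_JG (delta_mx a i)) X) (mx_JG (delta_mx j b)).
    exact: memvZ.
  rewrite -[LHS]JG_mxK -[RHS]JG_mxK; congr mx_JG.
  rewrite linearZ /= !JG_mxM !mx_JGK.
  have -> : delta_mx a i *m C *m JG_mx X *m C *m delta_mx j b =
     delta_mx a i *m (C *m JG_mx X *m C) *m delta_mx j b by rewrite !mulmxA.
  rewrite -/s; move: (C *m _ *m C) @s sij => M s sij.
  apply/matrixP => x y; rewrite !mxE (bigD1 j) //= big1 => [|l /negPf nl].
    rewrite !mxE (bigD1 i) //= big1 => [|l /negPf nl].
      rewrite !mxE !eqxx !andbT addr0 addr0 /s.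
      by case: (x == a); case: (y == b); rewrite ?(mul0r, mulr0, mul1r, mulr1) ?mulVf.
    by rewrite mxE nl andbF mul0r.
  by rewrite [X in _ * X]mxE nl mulr0.
have [m mP] := Inil.
have := mP E (nseq m E); rewrite size_nseq all_nseq [mem I E]EI orbT.
move=> /(_ erefl EI isT).
have EE : JGmul E E = C b a *: E.
  rewrite -[LHS]JG_mxK -[RHS]JG_mxK; congr mx_JG; rewrite JG_mxM linearZ /= mx_JGK.
  apply/matrixP => x y; rewrite !mxE (bigD1 a) //= big1 => [|l /negPf nl].
    rewrite !mxE (bigD1 b) //= big1 => [|l /negPf nl].
      rewrite !mxE !eqxx !andbT addr0 addr0.
      by case: (x == a); case: (y == b); rewrite ?(mul0r, mulr0, mul1r, mulr1).
    by rewrite mxE nl andbF mul0r.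
  by rewrite [X in _ * X]mxE nl mulr0.
have E0 : E != 0.
  apply: contra_neq (oner_neq0 F) => E0.
  have /matrixP/(_ a b) : JG_mx E = 0 by rewrite E0 linear0.
  by rewrite mx_JGK !mxE !eqxx.
(* Each further factor E multiplies the accumulator of [foldl] by C b a, so the induction is over
   all nonzero multiples of E. *)
suff Em c t : c != 0 -> foldl JGmul (c *: E) (nseq t E) != 0.
  by move=> foldE; have := Em 1 m (oner_neq0 F); rewrite scale1r foldE eqxx.
elim: t c => [|t IH] c c0 /=; first by rewrite scaler_eq0 negb_or c0.
have -> : JGmul (c *: E) E = (c * C b a) *: E.
  rewrite -[LHS]JG_mxK -[RHS]JG_mxK; congr mx_JG.
  by rewrite JG_mxM !linearZ /= -!scalemxAl -JG_mxM EE linearZ /= scalerA.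
by apply: IH; rewrite mulf_neq0.
Qed.

End Radical.

Theorem proposition3p8 (k : closedFieldType) (k_char0 : [pchar k] =i pred0)
    (gT : finGroupType) (G : {group gT}) (R : realType) :
  exists Jac : {vspace JG k G R[i]},
    [/\ is_jacobson JGmul Jac,
        [set` Jac]%classic =
          [set Y + Z | Y in tens_sub (KG k G R[i]) setT &
                       Z in tens_sub setT (KG k G R[i])]%classic,
        [set` Jac]%classic =
          [set X : JG k G R[i] |
             CG k G R[i] *m JG_mx X *m CG k G R[i] = 0]%classic,
        quot_iso_mx JGmul Jac (\rank (CG k G R[i])) &
        \dim Jac = (nG k G ^ 2 - \rank (CG k G R[i]) ^ 2)%N].
Proof.
exists (JG_rad k G R[i]); split; last exact: dim_JG_rad.
- exact: JG_rad_jacobson.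
- apply/seteqP; split=> X /=.
    move=> /JG_radP/tens_sub_KGP[Y [Z [YK ZK ->]]].
    by exists Y => //; exists Z.
  case=> Y YK [Z ZK <-]; apply/JG_radP/tens_sub_KGP.
  by exists Y, Z.
- by apply/seteqP; split=> X /= /JG_radP.
- exact: JG_rad_quot.
Qed.
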